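(* Let $\mathcal T=(S,\Sigma,\kappa)$ be a stochastic transition system, $B\in\Sigma$ and $\mu\in\mathrm{Dist}(S)$. (Almost-sure reachability) If $\mathcal T$ is decisive w.r.t. $B$ from $\mu$, then $$\mathrm{Prob}^{\mathcal T}_\mu(\mathbf F B)=1\iff\mathrm{Prob}^{\mathcal T}_\mu(\neg B\,\mathbf U\,\widetilde B)=0.$$ (Almost-sure repeated reachability) If $\mathcal T$ is strongly decisive w.r.t. $B$ from $\mu$, then $$\mathrm{Prob}^{\mathcal T}_\mu(\mathbf G\mathbf F B)=1\iff\mathrm{Prob}^{\mathcal T}_\mu(\mathbf F\widetilde B)=0.$$ (Positive repeated reachability) If $\mathcal T$ is decisive w.r.t. $\widetilde B$ from $\mu$ and persistently decisive w.r.t. $B$ from $\mu$, then $$\mathrm{Prob}^{\mathcal T}_\mu(\mathbf G\mathbf F B)>0\iff\mathrm{Prob}^{\mathcal T}_\mu(\mathbf F\widetilde{\widetilde B})>0.$$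
   Context: A stochastic transition system (STS) is $\mathcal T=(S,\Sigma,\kappa)$ where $(S,\Sigma)$ is a measurable space and $\kappa:S\times\Sigma\to[0,1]$ is a Markov kernel. $\mathrm{Dist}(S)$ is the set of probability measures on $(S,\Sigma)$; $\delta_s$ is the Dirac measure. For $\mu\in\mathrm{Dist}(S)$, $\mathrm{Prob}^{\mathcal T}_\mu$ is the law on infinite paths $s_0s_1\dots\in S^\omega$ (cylinder $\sigma$-algebra) of the Markov chain with initial distribution $\mu$ and kernel $\kappa$. Events: $\mathbf F B$: $\exists i\ge0,\ s_i\in B$; $\mathbf F_{\ge p}B$: $\exists i\ge p,\ s_i\in B$; $\mathbf G\mathbf F B$: $s_i\in B$ for infinitely many $i$; $\neg B\,\mathbf U\,C$: $\exists i\ge0$ with $s_i\in C$ and $s_j\notin B$ for all $0\le j<i$. Avoid-set: $\widetilde B=\{s\in S\mid\mathrm{Prob}^{\mathcal T}_{\delta_s}(\mathbf F B)=0\}$ (it belongs to $\Sigma$), and $\widetilde{\widetilde B}$ is the avoid-set of $\widetilde B$. $\mathcal T$ is decisive w.r.t. $B$ from $\mu$ if $\mathrm{Prob}^{\mathcal T}_\mu(\mathbf F B\vee\mathbf F\widetilde B)=1$; strongly decisive if $\mathrm{Prob}^{\mathcal T}_\mu(\mathbf G\mathbf F B\vee\mathbf F\widetilde B)=1$; persistently decisive if $\mathrm{Prob}^{\mathcal T}_\mu(\mathbf F_{\ge p}B\vee\mathbf F_{\ge p}\widetilde B)=1$ for every integer $p\ge0$. *)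

(* Defs.v *)
From HB Require Import structures.
From mathcomp Require Import all_boot all_order all_algebra.
From mathcomp Require Import all_classical all_reals all_analysis.
From mathcomp Require Import measurable_realfun.

Set Implicit Arguments.
Unset Strict Implicit.
Unset Printing Implicit Defensive.
Import Order.TTheory GRing.Theory Num.Theory.
Local Open Scope classical_set_scope.
Local Open Scope ring_scope.
Local Open Scope ereal_scope.

Definition coordinate_sets {d} (S : measurableType d) : set (set (nat -> S)) :=
  [set E | exists i (A : set S), measurable A /\ E = [set x | A (x i)]].
Arguments coordinate_sets {d} S _.

(* S^omega with the cylinder sigma-algebra *)
Definition paths {d} (S : measurableType d) : Type :=
  g_sigma_algebraType (coordinate_sets S).

HB.instance Definition _ d (S : measurableType d) :=
  Measurable.on (paths S).

Section path_law.
Context (R : realType) d (S : measurableType d).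
Implicit Types (kappa : R.-pker S ~> S) (mu : probability S R).
Implicit Types (P : probability (paths S) R) (A : nat -> set S).

(* [cylinder_prob kappa A n s] is the iterated integral
   \int_(A 0) kappa(s, ds_0) ... \int_(A n.-1) kappa(s_(n-2), ds_(n-1)) 1,
   i.e. the probability that the n steps following s lie in A 0, ..., A n.-1 *)
Fixpoint cylinder_prob kappa A n (s : S) : \bar R :=
  if n is n'.+1 then
    \int[kappa s]_(t in A 0%N) cylinder_prob kappa (fun i => A i.+1) n' t
  else 1.

Definition is_path_law kappa mu P := forall A n,
  (forall i, measurable (A i)) ->
  P [set x | forall i, (i <= n)%N -> A i (x i)] =
  \int[mu]_(s in A 0%N) cylinder_prob kappa (fun i => A i.+1) n s.

End path_law.

(* Ionescu-Tulcea: a path law exists for every kernel and initial distribution.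
   It is the Caratheodory extension of a content on [cylinders], the measurable
   sets of paths that depend on finitely many coordinates only. *)
Section path_space.
Context d (S : measurableType d).
Implicit Types (x y : paths S) (A : set (paths S)).

Definition agree n x y := forall i, (i < n)%N -> x i = y i.

Definition upd x k (t : S) : paths S := fun i => if i == k then t else x i.

Lemma agree_upd x y k t : agree k x y -> agree k.+1 (upd x k t) (upd y k t).
Proof.
by move=> xy i; rewrite /upd ltnS leq_eqVlt => /predU1P[->|/xy ->]; rewrite ?eqxx.
Qed.

Lemma agree_upd_self x k t : agree k x (upd x k t).
Proof. by move=> i ik; rewrite /upd (ltn_eqF ik). Qed.

Lemma agreeW m n x y : (m <= n)%N -> agree n x y -> agree m x y.
Proof. by move=> mn xy i im; apply: xy; exact: leq_trans mn. Qed.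

Lemma agreeC n x y : agree n x y -> agree n y x.
Proof. by move=> xy i /xy. Qed.

Lemma agree_trans n x y z : agree n x y -> agree n y z -> agree n x z.
Proof. by move=> xy yz i ilt; rewrite xy// yz. Qed.

Lemma measurable_to_paths d' (X : measurableType d') (f : X -> paths S) :
  (forall i, measurable_fun setT (fun z => f z i)) -> measurable_fun setT f.
Proof.
move=> mf; apply: (measurability (rT := paths S) (coordinate_sets S) (erefl _)).
by move=> _ [_ [i [A [mA ->]]] <-]; exact: mf.
Qed.

Lemma measurable_coord i : measurable_fun setT (fun x => x i).
Proof.
move=> _ A mA; rewrite setTI; apply: sub_sigma_algebra.
by exists i, A.
Qed.

Lemma measurable_upd k :
  measurable_fun setT (fun z : paths S * S => upd z.1 k z.2).
Proof.
apply: measurable_to_paths => i; rewrite /upd; case: eqP => _.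
  exact: measurable_snd.
exact: (measurableT_comp (@measurable_coord i) measurable_fst).
Qed.

Definition depends n A := forall x y, agree n x y -> A x -> A y.

Lemma dependsE n A x y : depends n A -> agree n x y -> A x = A y.
Proof. by move=> nA xy; apply/propext; split; apply: nA => //; exact: agreeC. Qed.

Lemma dependsW m n A : (m <= n)%N -> depends m A -> depends n A.
Proof. by move=> mn mA x y /(agreeW mn); exact: mA. Qed.

Lemma dependsC n A : depends n A -> depends n (~` A).
Proof. by move=> nA x y /agreeC xy nAx /(nA _ _ xy). Qed.

Lemma dependsU n A B : depends n A -> depends n B -> depends n (A `|` B).
Proof. by move=> nA nB x y xy [/(nA _ _ xy)|/(nB _ _ xy)]; [left|right]. Qed.

Definition cylinders : set (set (paths S)) :=
  [set A | measurable A /\ exists n, depends n A].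

Lemma cylinders0 : cylinders set0.
Proof. by split=> //; exists 0%N. Qed.

Lemma cylindersU : setU_closed cylinders.
Proof.
move=> A B [mA [m dA]] [mB [n dB]]; split; first exact: measurableU.
exists (m + n)%N; apply: dependsU.
- by apply: dependsW dA; exact: leq_addr.
- by apply: dependsW dB; exact: leq_addl.
Qed.

Lemma cylindersC : setC_closed cylinders.
Proof.
by move=> A [mA [n dA]]; split; [exact: measurableC|exists n; exact: dependsC].
Qed.

Definition cylinder_algebra : Type := paths S.

HB.instance Definition _ := Pointed.on cylinder_algebra.

Definition cylinder_display : measure_display.
Proof. exact: default_measure_display. Qed.

HB.instance Definition _ := @isAlgebraOfSets.Build cylinder_display
  cylinder_algebra cylinders cylinders0 cylindersU cylindersC.

Definition rank A : nat := xget 0%N [set n | depends n A].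

Lemma rankP A : cylinders A -> depends (rank A) A.
Proof. by move=> [_ [n nA]]; rewrite /rank; case: xgetP => [?->//|/(_ n)]. Qed.

End path_space.

Section ionescu_tulcea.
Context (R : realType) d (S : measurableType d).
Variables (kappa : R.-pker S ~> S) (mu : probability S R).
Implicit Types (x y : paths S) (A : set (paths S)).

Definition step k (x : paths S) : {measure set S -> \bar R} :=
  if k is k'.+1 then kappa (x k') else mu.

Lemma measurable_step k (U : set S) : measurable U ->
  measurable_fun [set: paths S] (step k ^~ U).
Proof.
move=> mU; case: k => [|k] /=; first exact: measurable_cst.
apply: (measurableT_comp (measurable_kernel kappa U mU)).
exact: measurable_coord.
Qed.

HB.instance Definition _ k :=
  isKernel.Build _ _ _ _ R (step k) (@measurable_step k).

Lemma stepT k x : step k x setT = 1.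
Proof. by case: k => [|k] /=; rewrite ?probability_setT ?prob_kernel. Qed.

HB.instance Definition _ k :=
  Kernel_isProbability.Build _ _ _ _ R (step k) (@stepT k).

Lemma agree_step k x y : agree k x y -> step k x = step k y.
Proof. by case: k => //= k /(_ k (ltnSn k)) ->. Qed.

Lemma eq_indic (T : Type) (A B : set T) (a b : T) : A a = B b ->
  (\1_A a)%:E = (\1_B b)%:E :> \bar R.
Proof.
move=> AB; rewrite !indicE; congr ((nat_of_bool _)%:R)%:E.
by apply/idP/idP => /set_mem; [rewrite AB|rewrite -AB] => /mem_set.
Qed.

(* probability of A given the first k states of x, drawing the next m states
   and keeping the coordinates of x from k + m on *)
Fixpoint draw k m A x : \bar R :=
  if m is m'.+1 then \int[step k x]_t draw k.+1 m' A (upd x k t)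
  else (\1_A x)%:E.

Lemma draw_ge0 k m A x : 0 <= draw k m A x.
Proof.
elim: m k x => [|m IH] k x /=; first by rewrite lee_fin.
by apply: integral_ge0 => t _.
Qed.

Lemma measurable_draw k m A : measurable A -> measurable_fun setT (draw k m A).
Proof.
move=> mA; elim: m k => [|m IH] k /=.
  by apply/measurable_EFinP; exact: measurable_indic.
pose f (z : paths S * S) := draw k.+1 m A (upd z.1 k z.2).
apply: (measurable_fun_integral_finite_kernel f (step k)).
  by move=> z; exact: draw_ge0.
exact: (measurableT_comp (IH k.+1) (@measurable_upd _ _ k)).
Qed.

Lemma measurable_draw_upd k l m A x : measurable A ->
  measurable_fun setT (fun t => draw k m A (upd x l t)).
Proof.
move=> mA; apply: (measurableT_comp (measurable_draw k m mA)).
apply: (measurableT_comp (@measurable_upd _ _ l) (measurable_pair1 x)).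
Qed.

Lemma draw_local k m A B x :
  (forall y, agree k x y -> A y = B y) -> draw k m A x = draw k m B x.
Proof.
elim: m k x => [|m IH] k x AB /=.
  by apply: eq_indic; exact: AB.
apply: eq_integral => t _; apply: IH => y xy; apply: AB.
by apply: agree_trans (agreeW (leqnSn k) xy); exact: agree_upd_self.
Qed.

Lemma draw_depends k m A x y : depends (k + m) A -> agree k x y ->
  draw k m A x = draw k m A y.
Proof.
elim: m k x y => [|m IH] k x y.
  by rewrite addn0 => kA xy; apply: eq_indic; exact: dependsE xy.
move=> kA xy /=; rewrite (agree_step xy); apply: eq_integral => t _.
by apply: IH; [rewrite addSnnS|exact: agree_upd].
Qed.

Lemma drawS k m A x : depends (k + m) A -> draw k m.+1 A x = draw k m A x.
Proof.
elim: m k x => [|m IH] k x.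
  rewrite addn0 => kA /=.
  have E t : (\1_A (upd x k t))%:E = (\1_A x)%:E :> \bar R.
    by apply/esym/eq_indic/(dependsE kA); exact: agree_upd_self.
  under eq_integral do rewrite E.
  by rewrite integral_cst// [step k x _]stepT mule1.
by rewrite -addSnnS => kA; apply: eq_integral => t _; exact: IH.
Qed.

Lemma draw_stable k m n A x : depends (k + m) A -> (m <= n)%N ->
  draw k n A x = draw k m A x.
Proof.
move=> mA /subnK <-; elim: (n - m)%N => [//|j IH].
rewrite addSn drawS//; apply: dependsW mA.
by rewrite leq_add2l leq_addl.
Qed.

Lemma draw_le k m A B x : measurable A -> measurable B -> A `<=` B ->
  draw k m A x <= draw k m B x.
Proof.
move=> mA mB AB; elim: m k x => [|m IH] k x /=.
  rewrite lee_fin !indicE ler_nat.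
  by case: (boolP (x \in A)) => // /set_mem /AB /mem_set ->.
apply: ge0_le_integral => // [t _||].
- exact: draw_ge0.
- exact: measurable_draw_upd.
- exact: measurable_draw_upd.
Qed.

Lemma drawU k m A B x : measurable A -> measurable B -> A `&` B = set0 ->
  draw k m (A `|` B) x = draw k m A x + draw k m B x.
Proof.
move=> mA mB AB; elim: m k x => [|m IH] k x /=.
  rewrite -EFinD !indicE in_setU -natrD.
  have : ~ (A `&` B) x by rewrite AB.
  case: (boolP (x \in A)) => xA; case: (boolP (x \in B)) => xB //= [].
  by split; exact: set_mem.
under eq_integral do rewrite IH.
apply: ge0_integralD => // [t _||t _|].
- exact: draw_ge0.
- exact: measurable_draw_upd.
- exact: draw_ge0.
- exact: measurable_draw_upd.
Qed.

Definition cond_prob k A x := draw k (rank A) A x.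

Lemma cond_probE k m A x : cylinders A -> depends (k + m) A ->
  cond_prob k A x = draw k m A x.
Proof.
move=> cA mA; rewrite /cond_prob.
have rA : depends (k + rank A) A.
  by apply: dependsW (rankP cA); exact: leq_addl.
rewrite -(@draw_stable k (rank A) (rank A + m)%N A x rA (leq_addr _ _)).
by rewrite (@draw_stable k m)// leq_addl.
Qed.

Lemma cond_prob_ge0 k A x : 0 <= cond_prob k A x.
Proof. exact: draw_ge0. Qed.

Lemma cond_prob_depends k A x y : cylinders A -> agree k x y ->
  cond_prob k A x = cond_prob k A y.
Proof.
move=> cA; apply: draw_depends.
by apply: dependsW (rankP cA); exact: leq_addl.
Qed.

Lemma cond_prob_indic k A x : cylinders A -> depends k A ->
  cond_prob k A x = (\1_A x)%:E.
Proof. by move=> cA kA; rewrite (@cond_probE k 0)// addn0. Qed.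

Lemma cond_probS k A x : cylinders A ->
  cond_prob k A x = \int[step k x]_t cond_prob k.+1 A (upd x k t).
Proof.
move=> cA; have rA := rankP cA.
rewrite (@cond_probE k (rank A).+1)//; last first.
  by apply: dependsW rA; rewrite (leq_trans (leqnSn _))// leq_addl.
Qed.

Definition pre_law (A : set (cylinder_algebra S)) : \bar R :=
  cond_prob 0 A point.

Lemma pre_law_ge0 A : 0 <= pre_law A. Proof. exact: cond_prob_ge0. Qed.

Lemma pre_law0 : pre_law set0 = 0.
Proof.
rewrite /pre_law cond_prob_indic ?indicE ?in_set0//; exact: cylinders0.
Qed.

Lemma pre_law_semi_additive : measure_function.semi_additive pre_law.
Proof.
apply/(additive2P pre_law0) => A B cA cB AB.
have rA := rankP cA; have rB := rankP cB.
pose m := (rank A + rank B)%N.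
have mA : depends m A by apply: dependsW rA; exact: leq_addr.
have mB : depends m B by apply: dependsW rB; exact: leq_addl.
rewrite /pre_law (@cond_probE 0 m)//; last 2 first.
- exact: cylindersU.
- exact: dependsU.
rewrite !(@cond_probE 0 m)// drawU//; [exact: cA.1|exact: cB.1].
Qed.

Lemma pre_law_sigma_subadditive : measurable_subset_sigma_subadditive pre_law.
Proof.
move=> A F cF cA AF.
pose h k x := \sum_(i <oo) cond_prob k (F i) x.
rewrite leNgt; apply/negP => lt0.
have next k x : h k x < cond_prob k A x ->
    exists t, h k.+1 (upd x k t) < cond_prob k.+1 A (upd x k t).
  move=> hk; apply: contrapT => /forallNP ge; move: hk; apply/negP.
  rewrite -leNgt (cond_probS _ _ cA) /h.
  under eq_eseriesr do rewrite (cond_probS _ _ (cF _)).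
  rewrite -integral_nneseries//; last 2 first.
  - by move=> i; apply: measurable_draw_upd; exact: (cF i).1.
  - by move=> i t _; exact: cond_prob_ge0.
  apply: ge0_le_integral => //.
  - by move=> t _; exact: cond_prob_ge0.
  - by apply: measurable_draw_upd; exact: cA.1.
  - apply: ge0_emeasurable_sum => [i t _ _|i _]; first exact: cond_prob_ge0.
    by apply: measurable_draw_upd; exact: (cF i).1.
  - by move=> t _; rewrite leNgt; apply/negP; exact: ge.
pose nxt k x := xget point
  [set t | h k.+1 (upd x k t) < cond_prob k.+1 A (upd x k t)].
pose fix run k : paths S := if k is k'.+1 then upd (run k') k' (nxt k' (run k'))
  else point.
have runP k : h k (run k) < cond_prob k A (run k).
  elim: k => [|k IH]; first exact: lt0.
  have [t tP] := next _ _ IH; rewrite /= /nxt; case: xgetP => [//|/(_ t)].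
  by move/(_ tP).
have run_agree j k : (k <= j)%N -> agree k (run k) (run j).
  move=> /subnK <-; elim: (j - k)%N => [//|i IH].
  apply: agree_trans IH _; rewrite addSn.
  by apply: agreeW (@agree_upd_self _ _ _ _ _); exact: leq_addl.
pose y : paths S := fun i => run i.+1 i.
have yP k : agree k (run k) y.
  by move=> i ik; rewrite /y; apply/esym; apply: (run_agree k i.+1).
have {}runP k : h k y < cond_prob k A y.
  rewrite -(cond_prob_depends cA (yP k)).
  rewrite (_ : h k y = h k (run k)); first exact: runP.
  by apply: eq_eseriesr => i _; rewrite -(cond_prob_depends (cF i) (yP k)).
have Ay : A y.
  have := runP (rank A); rewrite cond_prob_indic//; last exact: rankP.
  rewrite indicE; case: (boolP (y \in A)) => [/set_mem//|_ /=].
  rewrite ltNge => /negP[]; apply: nneseries_ge0 => i _ _.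
  exact: cond_prob_ge0.
have [i _ Fiy] := AF _ Ay.
pose k := (rank A + rank (F i))%N.
have := runP k; apply/negP; rewrite -leNgt.
rewrite cond_prob_indic//; last first.
  by apply: dependsW (rankP cA); exact: leq_addr.
have -> : (\1_A y)%:E = cond_prob k (F i) y.
  rewrite cond_prob_indic; [by rewrite !indicE !mem_set|exact: cF|].
  by apply: dependsW (rankP (cF i)); exact: leq_addl.
rewrite /h (nneseriesD1 (n := i))//.
  by rewrite leeDl//; apply: nneseries_ge0 => j _ _; exact: cond_prob_ge0.
by move=> j _; exact: cond_prob_ge0.
Qed.

HB.instance Definition _ := isContent.Build _ _ R pre_law
  pre_law_ge0 pre_law_semi_additive.

HB.instance Definition _ := Content_SigmaSubAdditive_isMeasure.Build _ R _
  pre_law pre_law_sigma_subadditive.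

Definition law (A : set (paths S)) : \bar R := measure_extension pre_law A.

Lemma measurable_cylinders A : measurable A ->
  (@measurable _ (cylinder_algebra S)).-sigma.-measurable A.
Proof.
apply: smallest_sub; first exact: smallest_sigma_algebra.
move=> _ [i [B [mB ->]]]; apply: sub_sigma_algebra; split.
  by have := @measurable_coord _ S i measurableT _ mB; rewrite setTI.
by exists i.+1 => x y /(_ i (ltnSn i)) /= ->.
Qed.

Lemma law_cylinder A : cylinders A -> law A = pre_law A.
Proof. by move=> cA; apply: measurable_mu_extE. Qed.

Lemma law0 : law set0 = 0. Proof. exact: measure0. Qed.

Lemma law_ge0 A : 0 <= law A. Proof. exact: measure_ge0. Qed.

Lemma law_semi_sigma_additive : semi_sigma_additive law.
Proof.
move=> F mF tF mUF; apply: measure_semi_sigma_additive => //.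
- by move=> i; exact: measurable_cylinders.
- exact: measurable_cylinders.
Qed.

HB.instance Definition _ := isMeasure.Build _ _ R law
  law0 law_ge0 law_semi_sigma_additive.

Lemma draw_set0 k m x : draw k m set0 x = 0.
Proof.
elim: m k x => [|m IH] k x /=; first by rewrite indic0.
by apply: integral0_eq => t _.
Qed.

Lemma lawT : law setT = 1.
Proof.
have cT : cylinders [set: paths S] by split=> //; exists 0%N.
rewrite law_cylinder// /pre_law cond_prob_indic ?indicT//; exact: cT.
Qed.

HB.instance Definition _ := Measure_isProbability.Build _ _ R law lawT.

Lemma draw_cylinder k n (A : nat -> set S) x :
  draw k n.+1 [set y | forall i, (i <= n)%N -> A i (y (k + i)%N)] x =
  \int[step k x]_(t in A 0%N) cylinder_prob kappa (fun i => A i.+1) n t.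
Proof.
elim: n k A x => [|n IH] k A x; rewrite [RHS]integral_mkcond;
  apply: eq_integral => t _; rewrite patchE.
  rewrite /= indicE; case: (boolP (t \in A 0%N)) => tA.
    rewrite mem_set// => i; rewrite leqn0 => /eqP ->.
    by rewrite addn0 /upd eqxx; exact: set_mem.
  rewrite memNset// => /(_ 0%N isT); rewrite addn0 /upd eqxx => /mem_set.
  by apply/negP.
rewrite -[LHS]/(draw k.+1 n.+1 _ (upd x k t)).
case: (boolP (t \in A 0%N)) => [/set_mem|/negP] tA; last first.
  rewrite (@draw_local _ _ _ set0) ?draw_set0// => y xy.
  apply/propext; split=> // /(_ 0%N isT).
  by rewrite addn0 -xy// /upd eqxx => /mem_set.
rewrite (@draw_local _ _ _
  [set y | forall i, (i <= n)%N -> A i.+1 (y (k.+1 + i)%N)]).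
  by rewrite (IH k.+1 (fun i => A i.+1)) /= /upd eqxx.
move=> y xy; apply/propext; split=> [yA i iltn|yA [|i] iltn].
- by rewrite addSnnS; exact: yA.
- by rewrite addn0 -xy// /upd eqxx.
- by rewrite -addSnnS; exact: yA.
Qed.

Lemma cylinder_set (A : nat -> set S) n : (forall i, measurable (A i)) ->
  cylinders [set x | forall i, (i <= n)%N -> A i (x i)].
Proof.
move=> mA; split; last first.
  by exists n.+1 => x y xy /= xA i iltn; rewrite -xy//; exact: xA.
rewrite (_ : mkset _ = \bigcap_(i in [set i | (i <= n)%N])
    [set x : paths S | A i (x i)]) //.
apply: bigcap_measurable => [|i _]; first by exists 0%N.
by have := @measurable_coord _ S i measurableT _ (mA i); rewrite setTI.
Qed.

Lemma law_is_path_law : is_path_law kappa mu law.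
Proof.
move=> A n mA; have cA := cylinder_set n mA.
rewrite [LHS](law_cylinder cA) /pre_law (@cond_probE 0 n.+1)//; last first.
  by move=> x y xy /= xA i iltn; rewrite -xy//; exact: xA.
exact: (draw_cylinder 0).
Qed.

Lemma is_path_law_unique (P Q : probability (paths S) R) :
  is_path_law kappa mu P -> is_path_law kappa mu Q ->
  forall E, measurable E -> P E = Q E.
Proof.
move=> lP lQ.
pose G : set (set (paths S)) := [set E | exists (A : nat -> set S) n,
  (forall i, measurable (A i)) /\ E = [set x | forall i, (i <= n)%N -> A i (x i)]].
apply: (measure_unique G (fun=> setT)) => //.
- apply/seteqP; split; apply: smallest_sub.
  + exact: smallest_sigma_algebra.
  + move=> _ [i [B [mB ->]]]; apply: sub_sigma_algebra.
    exists (fun j => if j == i then B else setT), i; split.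
      by move=> j; case: ifP.
    apply/seteqP; split=> x /= xB; last by have := xB i (leqnn i); rewrite eqxx.
    by move=> j _; case: eqP => [->|].
  + exact: sigma_algebra_measurable.
  + by move=> _ [A [n [mA ->]]]; exact: (cylinder_set n mA).1.
- move=> _ _ [A [m [mA ->]]] [B [n [mB ->]]].
  exists (fun i => (if (i <= m)%N then A i else setT) `&`
    (if (i <= n)%N then B i else setT)), (m + n)%N; split.
    by move=> i; apply: measurableI; case: ifP.
  apply/seteqP; split=> x /=.
    move=> [xA xB] i _; split; case: ifP => //; first exact: xA.
    exact: xB.
  move=> xAB; split=> i ile.
    have [] := xAB i; first by rewrite (leq_trans ile)// leq_addr.
    by rewrite ile.
  have [] := xAB i; first by rewrite (leq_trans ile)// leq_addl.
  by rewrite ile.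
- by move=> i; exists (fun=> setT), 0%N; split=> //; apply/seteqP; split.
- by rewrite bigcup_const//; exists 0%N.
- by move=> _ [A [n [mA ->]]]; exact: etrans (lP A n mA) (esym (lQ A n mA)).
- by move=> _ /=; rewrite probability_setT ltry.
Qed.

End ionescu_tulcea.

Theorem path_law_exists (R : realType) d (S : measurableType d)
    (kappa : R.-pker S ~> S) (mu : probability S R) :
  exists P : probability (paths S) R, is_path_law kappa mu P.
Proof. by exists (law kappa mu); exact: law_is_path_law. Qed.

Section decisiveness.
Context (R : realType) d (S : measurableType d) (kappa : R.-pker S ~> S).
Implicit Types (B C : set S) (mu : probability S R).

(* the choice is immaterial on measurable events: [is_path_law_unique] *)
Definition Prob mu : probability (paths S) R :=
  projT1 (cid (path_law_exists kappa mu)).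

Lemma ProbP mu : is_path_law kappa mu (Prob mu).
Proof. exact: (projT2 (cid (path_law_exists kappa mu))). Qed.

Definition reach B : set (paths S) := [set x | exists i, B (x i)].

Definition reach_from (p : nat) B : set (paths S) :=
  [set x | exists i, (p <= i)%N /\ B (x i)].

Definition reach_infinitely B : set (paths S) :=
  [set x | infinite_set [set i | B (x i)]].

Definition avoid_until B C : set (paths S) :=
  [set x | exists i, C (x i) /\ forall j, (j < i)%N -> ~ B (x j)].

Definition avoid_set B : set S := [set s | Prob (dirac s) (reach B) = 0].

Definition decisive B mu : Prop :=
  Prob mu (reach B `|` reach (avoid_set B)) = 1.

Definition strongly_decisive B mu : Prop :=
  Prob mu (reach_infinitely B `|` reach (avoid_set B)) = 1.

Definition persistently_decisive B mu : Prop := forall p : nat,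
  Prob mu (reach_from p B `|` reach_from p (avoid_set B)) = 1.

End decisiveness.

Arguments reach {d S} B.
Arguments reach_from {d S} p B.
Arguments reach_infinitely {d S} B.
Arguments avoid_until {d S} B C.

(* Main.v *)
(* Write A for the avoid-set of B. By the Markov property, almost surely B is
   never visited once A has been; moreover A is absorbing, since leaving A would
   give a positive probability of reaching B. Hence almost surely
   reach_infinitely B excludes reach A, and reach A excludes reaching the
   avoid-set of A. Persistent decisiveness, intersected over all p, gives strong
   decisiveness; the three equivalences then hold pathwise, off a null set. *)

From HB Require Import structures.
Require Import Defs.
From mathcomp Require Import all_boot all_order all_algebra.
From mathcomp Require Import all_classical all_reals all_analysis.
From mathcomp Require Import measurable_realfun giry.

Set Implicit Arguments.
Unset Strict Implicit.
Unset Printing Implicit Defensive.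
Import Order.TTheory GRing.Theory Num.Theory.
Local Open Scope classical_set_scope.
Local Open Scope ereal_scope.

(** * Unbounded index sets, almost-sure events, mixtures of probabilities *)

Lemma infinite_nat_setP (N : set nat) :
  infinite_set N <-> forall p, exists i, (p <= i)%N /\ N i.
Proof.
split=> [infN p|unbN].
  apply: contrapT => bN; apply: infN.
  apply: (sub_finite_set _ (finite_II p)) => i Ni /=.
  by rewrite ltnNge; apply/negP => pi; apply: bN; exists i.
move=> /finite_seqP[s Ns]; have [i [si]] := unbN (\max_(j <- s) j).+1.
by rewrite Ns => /= /(@leq_bigmax_seq _ s xpredT id i) /(_ isT); rewrite leqNgt si.
Qed.

Section probability_extra.
Context (R : realType) d (T : measurableType d) (P : probability T R).

(** With [aeP], this turns probabilities 0 and 1 into almost-everywhere statements, which can then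
    be combined path by path with [filterS]. *)
Lemma ae_notP (E : set T) : measurable E ->
  P E = 0 <-> {ae P, forall x, ~ E x}.
Proof.
move=> mE; rewrite -(negligibleP P mE) /almost_everywhere.
by rewrite -[in X in X <-> _](setCK E).
Qed.

Lemma aeP (E : set T) : measurable E -> P E = 1 <-> {ae P, forall x, E x}.
Proof.
move=> mE; have := ae_notP (measurableC mE).
have -> : {ae P, forall x, ~ (~` E) x} = {ae P, forall x, E x}.
  congr (almost_everywhere P); apply/seteqP; split=> x /=; last by move=> ?; apply.
  exact: contrapT.
rewrite probability_setC//; move=> [h1 h2]; split => [PE|/h2].
  by apply: h1; rewrite PE subee.
(* Cancelling in [1 - P E = 0] requires a finite [P E]. *)
have /fineK <- : P E \is a fin_num by exact: fin_num_measure.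
by rewrite -EFinB => -[/eqP]; rewrite subr_eq0 => /eqP <-.
Qed.

End probability_extra.

Section as_probability.
Context (R : realType) d (T : measurableType d) (m : measure T R).

(** The mass proof is an argument so that a probability structure can be attached to a measure whose
    mass is known only by a lemma, such as [kappa s]. *)
Definition as_probability of m setT = 1 : set T -> \bar R := m.

Variable mT : m setT = 1.

HB.instance Definition _ := Measure.on (as_probability mT).

HB.instance Definition _ :=
  Measure_isProbability.Build _ _ _ (as_probability mT) mT.

End as_probability.

(** The witness is the Giry bind of [mu] and [f]. It serves to mix laws over the starting state and
    to push [mu] through one step of the kernel. *)
Lemma probability_bind (R : realType) d d' (X : measurableType d)
    (Y : measurableType d') (mu : probability X R) (f : X -> probability Y R) :
  (forall A, measurable A -> measurable_fun setT (fun x => f x A)) ->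
  exists nu : probability Y R, forall h : Y -> \bar R,
    measurable_fun setT h -> (forall y, 0 <= h y) ->
    \int[nu]_y h y = \int[mu]_x \int[f x]_y h y.
Proof.
move=> mf; pose g : X -> giry Y R := fun x => f x.
have mg : measurable_fun setT g by exact: measurable_giry_codensity.
have gT : giry_bind mu mg setT = 1.
  have := @giry_int_bind _ _ _ _ _ mu _ mg (cst 1) (measurable_cst _) (fun=> lee01).
  rewrite /giry_int integral_cst// mul1e => ->.
  have gT x : g x setT = 1 by exact: (probability_setT (f x)).
  transitivity (\int[mu]_x (1 : \bar R)); last first.
    by rewrite integral_cst// mul1e; exact: (probability_setT mu).
  apply: eq_integral => x _; rewrite integral_cst// mul1e; exact: gT.
exists (as_probability gT) => h mh h0; exact: (giry_int_bind mu mg mh h0).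
Qed.

(** * Measurable path events and the pi-system of boxes *)

Section path_events.
Context d (S : measurableType d).
Implicit Types (A : nat -> set S) (B C : set S).

Definition box A n : set (paths S) := [set x | forall i, (i <= n)%N -> A i (x i)].

(** The events on which [is_path_law] prescribes the measure, and the generating pi-system for the
    Dynkin argument below. *)
Definition boxes : set (set (paths S)) :=
  [set E | exists A n, (forall i, measurable (A i)) /\ E = box A n].

Lemma measurable_box A n : (forall i, measurable (A i)) -> measurable (box A n).
Proof. by move=> mA; have [] := cylinder_set n mA. Qed.

Lemma boxes_setI_closed : setI_closed boxes.
Proof.
move=> _ _ [A [m [mA ->]]] [B [n [mB ->]]].
(* Each box is padded with [setT] beyond its own length, so that both fit in length [m + n]. *)
exists (fun i => (if (i <= m)%N then A i else setT) `&`
  (if (i <= n)%N then B i else setT)), (m + n)%N; split.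
  by move=> i; apply: measurableI; case: ifP.
apply/seteqP; split=> x /=.
  by move=> [xA xB] i _; split; case: ifP => //; [exact: xA|exact: xB].
move=> xAB; split=> i ile.
  by have [] := xAB i (leq_trans ile (leq_addr _ _)); rewrite ile.
by have [] := xAB i (leq_trans ile (leq_addl _ _)); rewrite ile.
Qed.

Lemma boxes_generate : @measurable _ (paths S) = <<s boxes >>.
Proof.
apply/seteqP; split; apply: smallest_sub.
- exact: smallest_sigma_algebra.
- move=> _ [i [B [mB ->]]]; apply: sub_sigma_algebra.
  exists (fun j => if j == i then B else setT), i; split.
    by move=> j; case: ifP.
  apply/seteqP; split=> x /= xB; last by have := xB i (leqnn i); rewrite eqxx.
  by move=> j _; case: eqP => [->|].
- exact: sigma_algebra_measurable.
- by move=> _ [A [n [mA ->]]]; exact: measurable_box.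
Qed.

Definition suffix_path n (x : paths S) : paths S := fun i => x (n + i)%N.

Lemma measurable_at i B : measurable B -> measurable [set x : paths S | B (x i)].
Proof. by move=> mB; have := @measurable_coord _ S i measurableT _ mB; rewrite setTI. Qed.

Lemma measurable_suffix_path n : measurable_fun setT (suffix_path n).
Proof. by apply: measurable_to_paths => i; exact: measurable_coord. Qed.

HB.instance Definition _ n :=
  @isMeasurableFun.Build _ _ _ _ (suffix_path n) (@measurable_suffix_path n).

Lemma measurable_suffix_preimage n (E : set (paths S)) :
  measurable E -> measurable (suffix_path n @^-1` E).
Proof. by move=> mE; rewrite -[X in measurable X]setTI; exact: measurable_suffix_path. Qed.

Lemma measurable_reach_from p B : measurable B -> measurable (reach_from p B).
Proof.
move=> mB; rewrite (_ : reach_from p B =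
    \bigcup_(i in [set i | (p <= i)%N]) [set x : paths S | B (x i)]).
  by apply: bigcup_measurable => i _; exact: measurable_at.
by apply/seteqP; split=> x [i]; [case=> pi Bi; exists i|move=> pi Bi; exists i].
Qed.

Lemma reachE B : reach B = reach_from 0 B.
Proof. by apply/seteqP; split=> x [i]; [exists i|case=> _; exists i]. Qed.

Lemma measurable_reach B : measurable B -> measurable (reach B).
Proof. by rewrite reachE; exact: measurable_reach_from. Qed.

Lemma reach_infinitelyE B : reach_infinitely B = \bigcap_p reach_from p B.
Proof.
apply/seteqP; split=> x; first by move=> /infinite_nat_setP xB p _; exact: xB.
by move=> xB; apply/infinite_nat_setP => p; exact: xB.
Qed.

Lemma measurable_reach_infinitely B : measurable B -> measurable (reach_infinitely B).
Proof.
move=> mB; rewrite reach_infinitelyE; apply: bigcapT_measurable => p.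
exact: measurable_reach_from.
Qed.

Lemma measurable_avoid_until B C :
  measurable B -> measurable C -> measurable (avoid_until B C).
Proof.
(* For a fixed time [i] of the visit to [C], the event is a box: outside [B] before [i], in [C] at
   [i]. *)
move=> mB mC; rewrite (_ : avoid_until B C =
    \bigcup_i box (fun j => if j == i then C else ~` B) i).
  apply: bigcup_measurable => i _; apply: measurable_box => j.
  by case: ifP => // _; exact: measurableC.
apply/seteqP; split=> x [i].
  move=> [Ci nB]; exists i => // j; rewrite leq_eqVlt.
  by case: eqP => [-> _//|_ /= ji]; exact: nB.
move=> _ xA; exists i; split; first by have := xA i (leqnn i); rewrite eqxx.
by move=> j ji; have := xA j (ltnW ji); rewrite (ltn_eqF ji).
Qed.

End path_events.

(** * Dependence on the starting state and total probability *)

Section markov.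
Context (R : realType) d (S : measurableType d) (kappa : R.-pker S ~> S).
Implicit Types (mu : probability S R) (A : nat -> set S) (B C : set S).

Lemma cylinder_prob_ge0 A n s : 0 <= cylinder_prob kappa A n s.
Proof.
by elim: n A s => [|n IH] A s /=; [exact: lee01|apply: integral_ge0 => t _].
Qed.

Lemma measurable_cylinder_prob A n : (forall i, measurable (A i)) ->
  measurable_fun setT (cylinder_prob kappa A n).
Proof.
elim: n A => [|n IH] A mA /=; first exact: measurable_cst.
under eq_fun do rewrite integral_mkcond.
apply: measurable_fun_integral_kernel.
- by move=> U mU; exact: measurable_kernel.
- by move=> t; apply: erestrict_ge0 => u _; exact: cylinder_prob_ge0.
- apply/(measurable_restrictT _ (mA 0%N)); apply: measurable_funTS.
  by apply: IH => i.
Qed.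

Lemma Prob_unique mu (P : probability (paths S) R) : is_path_law kappa mu P ->
  forall E, measurable E -> Prob kappa mu E = P E.
Proof. by move=> lP; apply: is_path_law_unique lP; exact: ProbP. Qed.

Lemma Prob_dirac_box A n s : (forall i, measurable (A i)) ->
  Prob kappa (dirac s) (box A n) =
  (\d_s (A 0%N))%R * cylinder_prob kappa (fun i => A i.+1) n s.
Proof.
move=> mA; rewrite [LHS](@ProbP _ _ _ kappa (dirac s) A n mA) integral_dirac//.
by apply: measurable_funTS; exact: measurable_cylinder_prob.
Qed.

(** [Prob] is chosen separately for each [s], so measurability in [s] does not come from its
    construction. It is read off the explicit formula on boxes and extended by Dynkin's theorem. *)
Lemma measurable_Prob_dirac (E : set (paths S)) : measurable E ->
  measurable_fun setT (fun s => Prob kappa (dirac s) E).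
Proof.
rewrite boxes_generate.
move: E; apply: (dynkin_induction (@boxes_generate _ S)).
- exact: boxes_setI_closed.
- under eq_fun do rewrite probability_setT; exact: measurable_cst.
- move=> _ [A [n [mA ->]]].
  under eq_fun do rewrite Prob_dirac_box//.
  apply: emeasurable_funM; first exact: measurable_fun_dirac.
  exact: measurable_cylinder_prob.
- move=> E mE hE; under eq_fun do rewrite probability_setC//.
  by apply: emeasurable_funB => //; exact: measurable_cst.
- move=> F mF tF hF.
  apply: (eq_measurable_fun (fun s => \sum_(0 <= k <oo) Prob kappa (dirac s) (F k))).
    by move=> s _; rewrite measure_semi_bigcup//; exact: bigcup_measurable.
  exact: ge0_emeasurable_sum.
Qed.

(** The mixture of the laws started at Dirac measures satisfies the box formula for [mu], hence
    equals [Prob kappa mu] by uniqueness. *)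
Lemma Prob_total mu E : measurable E ->
  Prob kappa mu E = \int[mu]_s Prob kappa (dirac s) E.
Proof.
move=> mE; have [P PE] := probability_bind mu measurable_Prob_dirac.
have {}PE F : measurable F -> P F = \int[mu]_s Prob kappa (dirac s) F.
  move=> mF; rewrite -(setIT F) -integral_indic// PE//.
    by apply: eq_integral => s _; rewrite integral_indic.
  by apply/measurable_EFinP; exact: measurable_indic.
rewrite -PE//; apply: Prob_unique => // A n mA.
rewrite -/(box A n) PE; last exact: measurable_box.
rewrite [RHS]integral_mkcond; apply: eq_integral => s _.
rewrite Prob_dirac_box// patchE diracE.
by case: ifP => _; rewrite ?mul1e ?mul0e.
Qed.

(** * Initial states, shifted paths and the Markov property *)

Lemma Prob_at0 mu B : measurable B -> Prob kappa mu [set x | B (x 0%N)] = mu B.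
Proof.
move=> mB; have := @ProbP _ _ _ kappa mu (fun=> B) 0%N (fun=> mB).
rewrite /= integral_cst// mul1e => <-; congr (Prob kappa mu _).
by apply/seteqP; split=> x /= xB; [move=> i; rewrite leqn0 => /eqP ->|exact: xB].
Qed.

Lemma Prob_dirac_at0 s B : measurable B ->
  Prob kappa (dirac s) [set x | B (x 0%N)] = (s \in B)%:R%:E.
Proof. by move=> mB; rewrite Prob_at0//; exact: diracE. Qed.

(** Here [nu] is the distribution of the state at time 1; the image of the law under the shift
    satisfies the box formula for [nu]. *)
Lemma Prob_suffix1 mu : exists nu : probability S R, forall E, measurable E ->
  Prob kappa mu (suffix_path 1 @^-1` E) = Prob kappa nu E.
Proof.
have [nu nuE] := @probability_bind _ _ _ _ _ mu
  (fun s => as_probability (prob_kernel s)) (measurable_kernel kappa).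
exists nu => E mE; apply/esym.
pose P : probability (paths S) R := distribution (Prob kappa mu) (suffix_path 1).
apply: (@Prob_unique nu P) => // A n mA.
have mf : measurable_fun setT (cylinder_prob kappa (fun i => A i.+1) n \_ (A 0%N)).
  apply/(measurable_restrictT _ (mA 0%N)); apply: measurable_funTS.
  by apply: measurable_cylinder_prob => i.
(* A box on the shifted path is a box one step longer, unconstrained at time 0. *)
pose A' i := if i is j.+1 then A j else setT.
transitivity (Prob kappa mu (box A' n.+1)).
  congr (Prob kappa mu _); apply/seteqP; split=> x /= xA.
    by case=> [//|i]; rewrite ltnS => ilt; have := xA i ilt.
  by move=> i ile; exact: (xA i.+1).
rewrite [LHS](@ProbP _ _ _ kappa mu A' n.+1); last by case=> [|j]; [exact: measurableT|exact: mA].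
rewrite [RHS]integral_mkcond nuE//; last first.
  by move=> t; apply: erestrict_ge0 => u _; exact: cylinder_prob_ge0.
by apply: eq_integral => s _ /=; rewrite [LHS]integral_mkcond.
Qed.

Lemma Prob_suffix n mu : exists nu : probability S R, forall E, measurable E ->
  Prob kappa mu (suffix_path n @^-1` E) = Prob kappa nu E.
Proof.
elim: n mu => [|n IH] mu; first by exists mu.
have [nu1 h1] := Prob_suffix1 mu; have [nu h] := IH nu1; exists nu => E mE.
rewrite -h// -h1//; exact: measurable_suffix_preimage.
Qed.

Lemma Prob_dirac_start mu B E : measurable B -> measurable E ->
  (forall s, B s -> Prob kappa (dirac s) E = 0) ->
  Prob kappa mu ([set x | B (x 0%N)] `&` E) = 0.
Proof.
move=> mB mE BE0; have mB0 := measurable_at 0 mB.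
rewrite Prob_total; last exact: measurableI.
apply: integral0_eq => s _; apply/eqP; rewrite eq_le measure_ge0 andbT.
(* From [s] in [B] the event [E] is null; from any other [s], starting in [B] is null. *)
have [Bs|nBs] := pselect (B s).
  by rewrite -(BE0 s Bs) le_measure ?inE//; exact: measurableI.
have <- : Prob kappa (dirac s) [set x | B (x 0%N)] = 0.
  by rewrite Prob_dirac_at0// memNset.
by rewrite le_measure ?inE//; exact: measurableI.
Qed.

(* The Markov property, restricted to null events: this is all that is needed,
   and it avoids conditioning on the history before time n. *)
Lemma ae_suffix_not mu B E : measurable B -> measurable E ->
  (forall s, B s -> Prob kappa (dirac s) E = 0) ->
  {ae Prob kappa mu, forall (x : paths S) n, B (x n) -> ~ E (suffix_path n x)}.
Proof.
move=> mB mE BE0; apply: ae_foralln => n.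
have mBE : measurable ([set x : paths S | B (x 0%N)] `&` E).
  by apply: measurableI => //; exact: measurable_at.
have [nu nuE] := Prob_suffix n mu.
have /(ae_notP _ (measurable_suffix_preimage n mBE)) :
  Prob kappa mu (suffix_path n @^-1` ([set x | B (x 0%N)] `&` E)) = 0.
  by rewrite nuE//; exact: Prob_dirac_start.
apply: filterS => x h Bx Ex; apply: h; split=> //.
by rewrite /suffix_path /= addn0.
Qed.

(** * Almost-sure behaviour of paths that meet an avoid-set *)

Lemma measurable_avoid_set B : measurable B -> measurable (avoid_set kappa B).
Proof.
move=> mB; have := measurable_Prob_dirac (measurable_reach mB).
move=> /(_ measurableT _ (emeasurable_set1 0)).
by rewrite setTI.
Qed.

Lemma avoid_setN B s : measurable B -> avoid_set kappa B s -> ~ B s.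
Proof.
move=> mB sB Bs; have mr := measurable_reach mB.
have : Prob kappa (dirac s) [set x | B (x 0%N)] <= Prob kappa (dirac s) (reach B).
  by apply: le_measure; rewrite ?inE//; [exact: measurable_at|move=> x Bx; exists 0%N].
by rewrite Prob_dirac_at0// mem_set// sB lee_fin ler10.
Qed.

(** By [Prob_total], a nonnegative function of the starting state has integral 0, so it vanishes
    almost everywhere. *)
Lemma null_setC_avoid_set mu B : measurable B -> Prob kappa mu (reach B) = 0 ->
  mu (~` avoid_set kappa B) = 0.
Proof.
move=> mB; have mr := measurable_reach mB; have mA := measurable_avoid_set mB.
rewrite Prob_total// => int0.
have : \int[mu]_s `|Prob kappa (dirac s) (reach B)| = 0.
  by rewrite -[RHS]int0; apply: eq_integral => s _; rewrite gee0_abs.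
move=> /(ae_eq_integral_abs mu measurableT (measurable_Prob_dirac mr)) ae0.
apply/(ae_notP _ (measurableC mA)).
by apply: filterS ae0 => s h; apply; exact: h.
Qed.

Lemma ae_avoid_never mu B : measurable B -> {ae Prob kappa mu,
  forall (x : paths S) n i, avoid_set kappa B (x n) -> ~ B (x (n + i)%N)}.
Proof.
move=> mB; have mA := measurable_avoid_set mB; have mr := measurable_reach mB.
have never := ae_suffix_not mu mA mr (fun s => id).
by apply: filterS never => x h n i An Bni; apply: (h n An); exists i.
Qed.

Lemma ae_avoid_absorbing mu B : measurable B -> {ae Prob kappa mu,
  forall (x : paths S) n i, avoid_set kappa B (x n) -> avoid_set kappa B (x (n + i)%N)}.
Proof.
move=> mB; have mA := measurable_avoid_set mB; have mr := measurable_reach mB.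
(* The double negation gives the shape of [ae_suffix_not], whose event is here being outside the
   avoid-set after [i] steps. *)
suff : {ae Prob kappa mu, forall (x : paths S) i n,
    avoid_set kappa B (x n) -> ~ ~ avoid_set kappa B (suffix_path n x i)}.
  by apply: filterS => x h n i /(h i n) /contrapT.
have mC := measurableC mA; apply: ae_foralln => i.
apply: (ae_suffix_not mu mA (measurable_at i mC)) => s As.
have [nu nuE] := Prob_suffix i (dirac s).
have -> : [set x : paths S | (~` avoid_set kappa B) (x i)] =
    suffix_path i @^-1` [set x | (~` avoid_set kappa B) (x 0%N)].
  by apply/seteqP; split=> x; rewrite /= /suffix_path addn0.
rewrite nuE ?Prob_at0//; last exact: measurable_at.
(* With [nu] the distribution after [i] steps from [s], reaching [B] from [nu] means reaching it
   from [s] at time [i] or later, which is null by [As]. *)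
apply: null_setC_avoid_set => //; rewrite -nuE//.
apply/eqP; rewrite eq_le measure_ge0 andbT -[leRHS]As le_measure ?inE//.
  exact: measurable_suffix_preimage.
by move=> x [j Bj]; exists (i + j)%N.
Qed.

Lemma ae_not_both_avoided mu B : measurable B -> {ae Prob kappa mu, forall (x : paths S),
  reach (avoid_set kappa B) x ->
  ~ reach (avoid_set kappa (avoid_set kappa B)) x}.
Proof.
move=> mB; have mA := measurable_avoid_set mB.
have := ae_avoid_never mu mA; apply: filterS2 (ae_avoid_absorbing mu mB).
move=> x absorbing never [n An] [m AAm].
(* If the avoid-set comes first, absorption puts [x m] in it and in its own avoid-set, which are
   disjoint; otherwise it is visited after its avoid-set, which [never] forbids. *)
case/orP: (leq_total n m) => [/subnKC nm|/subnKC mn].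
- by apply: avoid_setN AAm _ => //; rewrite -nm; exact: absorbing.
- by apply: (never m (n - m)%N AAm); rewrite mn.
Qed.

Lemma ae_not_infinitely_avoided mu B : measurable B -> {ae Prob kappa mu,
  forall (x : paths S), reach_infinitely B x -> ~ reach (avoid_set kappa B) x}.
Proof.
move=> mB; apply: filterS (ae_avoid_never mu mB) => x never xB [n An].
have [i [/subnKC <-]] := (infinite_nat_setP _).1 xB n.
exact: never.
Qed.

Lemma persistently_decisive_strongly mu B : measurable B ->
  persistently_decisive kappa B mu -> strongly_decisive kappa B mu.
Proof.
move=> mB pB; have mA := measurable_avoid_set mB.
apply/aeP.
  by apply: measurableU; [exact: measurable_reach_infinitely|exact: measurable_reach].
have /ae_foralln : forall p, {ae Prob kappa mu, forall (x : paths S),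
    (reach_from p B `|` reach_from p (avoid_set kappa B)) x}.
  move=> p; apply/aeP; last exact: pB.
  by apply: measurableU; exact: measurable_reach_from.
apply: filterS => x h.
(* On a path that misses the avoid-set, each [p] must yield a visit to [B] at time [p] or later. *)
have [[n An]|nA] := pselect (reach (avoid_set kappa B) x); first by right; exists n.
left; apply/infinite_nat_setP => p; have [//|[i [_ Ai]]] := h p.
by exfalso; apply: nA; exists i.
Qed.

End markov.

Theorem proposition52 (R : realType) (d : measure_display)
    (S : measurableType d) (kappa : R.-pker S ~> S) (B : set S)
    (mB : measurable B) (mu : probability S R) :
  [/\ decisive kappa B mu ->
        (Prob kappa mu (reach B) = 1 <->
         Prob kappa mu (avoid_until B (avoid_set kappa B)) = 0),
      strongly_decisive kappa B mu ->
        (Prob kappa mu (reach_infinitely B) = 1 <->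
         Prob kappa mu (reach (avoid_set kappa B)) = 0)
    & decisive kappa (avoid_set kappa B) mu ->
      persistently_decisive kappa B mu ->
        (0 < Prob kappa mu (reach_infinitely B) <->
         0 < Prob kappa mu (reach (avoid_set kappa (avoid_set kappa B))))].
Proof.
have mA := measurable_avoid_set kappa mB.
have mAA := measurable_avoid_set kappa mA.
have mrB := measurable_reach mB; have mrA := measurable_reach mA.
have mrAA := measurable_reach mAA; have miB := measurable_reach_infinitely mB.
have excl := ae_not_infinitely_avoided kappa mu mB.
split.
- have mU := measurable_avoid_until mB mA.
  move=> /(aeP _ (measurableU _ _ mrB mrA)) dec.
  rewrite (aeP _ mrB) (ae_notP _ mU); split.
    (* The visit to [B] at [k] can come neither before [i], by [nB], nor from [i] on, by [never]. *)
    apply: filterS2 (ae_avoid_never kappa mu mB) => x never [k Bk] [i [Ai nB]].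
    have [/subnKC ik|/nB//] := leqP i k.
    by apply: (never i (k - i)%N Ai); rewrite ik.
  (* If [B] were never visited, any visit to the avoid-set would witness the until event. *)
  apply: filterS2 dec => x [//|[i Ai]] nU.
  apply: contrapT => nB; apply: nU; exists i; split=> // j _ Bj.
  by apply: nB; exists j.
- move=> /(aeP _ (measurableU _ _ miB mrA)) dec.
  rewrite (aeP _ miB) (ae_notP _ mrA); split.
    by apply: filterS2 excl => x; apply.
  by apply: filterS2 dec => x [].
- move=> /(aeP _ (measurableU _ _ mrA mrAA)) dec /(persistently_decisive_strongly mB).
  move=> /(aeP _ (measurableU _ _ miB mrA)) sdec.
  have both := ae_not_both_avoided kappa mu mB.
  (* Positivity passes along almost-sure inclusions, so both directions reduce to pathwise
     implications. *)
  have pos E F : measurable E -> measurable F ->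
      {ae Prob kappa mu, forall x, E x -> F x} ->
      0 < Prob kappa mu E -> 0 < Prob kappa mu F.
    move=> mE mF EF; rewrite !lt0e !measure_ge0 !andbT; apply: contra_neq.
    move=> /(ae_notP _ mF) nF; apply/(ae_notP _ mE).
    by apply: filterS2 EF nF => x EF nF /EF.
  split; apply: pos => //.
    (* Infinitely many visits to [B] exclude the avoid-set, so decisiveness with respect to it
       leaves only its own avoid-set; conversely, reaching the latter excludes the avoid-set, and
       strong decisiveness gives the infinitely many visits. *)
    by apply: filterS2 excl dec => x nA [/[swap] /nA|].
  by apply: filterS2 both sdec => x nA [//|/nA].
Qed.
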